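(* Let $Y\in\mathbb{R}^{n\times n}$ be a symmetric matrix and consider the symmetric matrix factorization objective $f:\mathbb{R}^{n\times r}\to\mathbb{R}$, $$f(U)=\frac12\|UU^\top-Y\|_F^2 .$$ Then the following statements hold. (i) For any $L_1>0$ there exists an $L_0>0$ such that $f$ is $(L_0,L_1)$-smooth. (ii) If $\phi$ is a reference function on $\mathbb{R}^{nr}$ satisfying conditions (S) and (I) given in the context, then for any $\bar L>0$ there exists an $L>0$ such that $f$ satisfies the second-order characterization of $(L,\bar L)$-anisotropic smoothness relative to $\phi$.
   Context: The variable $U\in\mathbb{R}^{n\times r}$ is identified with its vectorization in $\mathbb{R}^{N}$, $N=nr$ (so the Euclidean norm of the variable and of the gradient is the Frobenius norm). $\|\cdot\|$ is the Euclidean norm on vectors and the spectral norm on matrices (in particular on Hessians); $\|\cdot\|_F$ is the Frobenius norm; $\mathbb{R}_+=[0,\infty)$. A twice continuously differentiable $f:\mathbb{R}^N\to\mathbb{R}$ is $(L_0,L_1)$-smooth, with $L_0,L_1\ge0$, if $\|\nabla^2 f(x)\|\le L_0+L_1\|\nabla f(x)\|$ for all $x$. Standing assumption: a reference function is a function $\phi:\mathbb{R}^N\to\overline{\mathbb{R}}$ that is proper, lower semicontinuous, strongly convex and even, with $\phi(0)=0$; $\phi^*$ is its convex conjugate. $f$ satisfies the second-order characterization of $(L,\bar L)$-anisotropic smoothness relative to $\phi$ if $\lambda_{\max}(\nabla^2\phi^*(\bar L^{-1}\nabla f(x))\nabla^2 f(x))\le L\bar L$ for all $x\in\mathbb{R}^N$.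 Condition (S): $\operatorname{int}\operatorname{dom}\phi\ne\emptyset$; $\phi\in\mathcal{C}^2(\operatorname{int}\operatorname{dom}\phi)$; and for any sequence $(x^k)$ converging to some boundary point of $\operatorname{int}\operatorname{dom}\phi$, $\|\nabla\phi(x^k)\|\to\infty$. (This ensures in particular $\phi^*\in\mathcal{C}^2(\mathbb{R}^N)$.) Condition (I): $\phi$ is isotropic, i.e. $\phi(x)=h(\|x\|)$ for a scalar kernel function $h:\mathbb{R}\to\mathbb{R}_+\cup\{\infty\}$, and, with $h^*$ the convex conjugate of $h$: (i) ${h^*}'(y)/y$ is a decreasing function on $\mathbb{R}_+$; (ii) $\lim_{y\to+\infty}y\,{h^*}''(y)=C_2$ for some $C_2\in\mathbb{R}_+$; (iii) $\lim_{y\to+\infty}{h^*}'(s_d(y))/y=0$ for any polynomial $s_d(\alpha)=\sum_{i=0}^d u_i\alpha^i$ of degree $d$. *)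

(* Defs.v *)
From mathcomp Require Import all_boot all_order all_algebra.
From mathcomp Require Import all_classical all_reals all_analysis.

Set Implicit Arguments.
Unset Strict Implicit.
Unset Printing Implicit Defensive.

Import Order.TTheory GRing.Theory Num.Theory.
Import numFieldNormedType.Exports.

Local Open Scope classical_set_scope.
Local Open Scope ring_scope.

(* The variable U is vectorized by mxvec, so R^N is 'rV[R]_N with N = n * r.
   The library norm `|_| on matrices is the max norm; it is only used through
   the (equivalent) topology it induces. *)

(* On row or column vectors this is the Euclidean norm. *)
Definition frobenius_norm {R : realType} {m n : nat} (A : 'M[R]_(m, n)) : R :=
  Num.sqrt (\sum_(i < m) \sum_(j < n) A i j ^+ 2).

Definition spectral_norm {R : realType} {m n : nat} (A : 'M[R]_(m, n)) : R :=
  sup [set frobenius_norm (A *m x) |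
        x in [set x : 'cV[R]_n | frobenius_norm x <= 1]].

Definition dot {R : realType} {N : nat} (x y : 'rV[R]_N) : R :=
  (x *m y^T) 0 0.

(* Largest real eigenvalue.  It is applied below to the product of a positive
   semidefinite and a symmetric matrix, which has a real spectrum. *)
Definition lambda_max {R : realType} {N : nat} (A : 'M[R]_N) : R :=
  sup [set a : R | eigenvalue A a].

Section calculus.
Context {R : realType} {N : nat}.
Implicit Types (g : 'rV[R]_N -> R) (D : set 'rV[R]_N).

Definition grad g (x : 'rV[R]_N) : 'rV[R]_N :=
  \row_(i < N) 'D_(delta_mx 0 i) g x.

Definition hess g (x : 'rV[R]_N) : 'M[R]_N :=
  \matrix_(i < N, j < N) 'D_(delta_mx 0 j) (fun y => 'D_(delta_mx 0 i) g y) x.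

(* g is C^2 on the open set D. *)
Definition C2_on D g : Prop :=
  forall x, D x -> [/\ differentiable g x, differentiable (grad g) x
                     & {for x, continuous (hess g)}].

Definition L0L1_smooth (L0 L1 : R) (f : 'rV[R]_N -> R) : Prop :=
  C2_on setT f /\
  forall x, spectral_norm (hess f x) <= L0 + L1 * frobenius_norm (grad f x).

End calculus.

(* Convex conjugate with respect to the pairing b. *)
Definition convex_conjugate {R : realType} {T : Type} (b : T -> T -> R)
    (phi : T -> \bar R) (y : T) : \bar R :=
  ereal_sup [set ((b x y)%:E - phi x)%E | x in [set: T]].

Section reference_functions.
Context {R : realType} {N : nat}.
Implicit Types phi : 'rV[R]_N -> \bar R.

Definition proper_ereal phi : Prop :=
  (forall x, phi x != -oo%E) /\ (exists x, (phi x < +oo)%E).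

Definition strongly_convex phi : Prop :=
  exists2 mu : R, 0 < mu &
    forall (x y : 'rV[R]_N) (t : R), 0 < t < 1 ->
      (phi (t *: x + (1 - t) *: y)%R
         + (mu / 2 * t * (1 - t) * frobenius_norm (x - y) ^+ 2)%R%:E
       <= t%:E * phi x + (1 - t)%R%:E * phi y)%E.

Definition reference_function phi : Prop :=
  [/\ proper_ereal phi, lower_semicontinuous phi, strongly_convex phi,
      (forall x, phi (- x) = phi x) & phi 0 = 0%E].

Definition int_dom phi : set 'rV[R]_N := interior [set x | (phi x < +oo)%E].

Definition condition_S phi : Prop :=
  [/\ int_dom phi !=set0,
      C2_on (int_dom phi) (fine \o phi)
    & forall (u : nat -> 'rV[R]_N) (x : 'rV[R]_N),
        (forall k, int_dom phi (u k)) ->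
        (closure (int_dom phi) `\` int_dom phi) x ->
        u k @[k --> \oo] --> x ->
        frobenius_norm (grad (fine \o phi) (u k)) @[k --> \oo] --> +oo].

(* f satisfies the second-order characterization of
   (L, Lbar)-anisotropic smoothness relative to phi; phi^* is finite everywhere
   for a reference function phi, so fine only casts it to a real function. *)
Definition anisotropic_smooth2 phi (L Lbar : R) (f : 'rV[R]_N -> R) : Prop :=
  forall x : 'rV[R]_N,
    lambda_max (hess (fine \o convex_conjugate dot phi) (Lbar^-1 *: grad f x)
                *m hess f x) <= L * Lbar.

End reference_functions.

(* hs stands for the (real-valued part of the) conjugate h^*.  The quotient
   hs'(y) / y only makes sense for y > 0; "decreasing" is not strict. *)
Definition kernel_conditions {R : realType} (hs : R -> R) : Prop :=
  [/\ (forall y z : R, 0 < y -> y <= z ->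
         derive1 hs z / z <= derive1 hs y / y),
      (exists2 C2 : R, 0 <= C2 &
         y * derive1n 2 hs y @[y --> +oo] --> C2)
    & (forall s : {poly R},
         derive1 hs s.[y] / y @[y --> +oo] --> (0 : R))].

Definition condition_I {R : realType} {N : nat} (phi : 'rV[R]_N -> \bar R) :
    Prop :=
  exists h : R -> \bar R,
    [/\ (forall t, (0 <= h t)%E),
        (forall x, phi x = h (frobenius_norm x))
      & kernel_conditions (fine \o convex_conjugate *%R h)].

Definition symmetric_factorization {R : realType} {n r : nat} (Y : 'M[R]_n)
    (U : 'M[R]_(n, r)) : R :=
  2^-1 * frobenius_norm (U *m U^T - Y) ^+ 2.

(* Main.v *)
Require Import Defs.
From mathcomp Require Import all_boot all_order all_algebra.
From mathcomp Require Import all_classical all_reals all_analysis ring lra.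

Set Implicit Arguments.
Unset Strict Implicit.
Unset Printing Implicit Defensive.

Import Order.TTheory GRing.Theory Num.Theory.
Import numFieldNormedType.Exports.

Local Open Scope classical_set_scope.
Local Open Scope ring_scope.

(** Part (i).  The objective is a polynomial of degree 4 in the entries of U, so
    its Hessian entries are of size O(1 + |U|^2).  Its radial derivative
    <grad f(U), U> is bounded below by |U U^T|^2 - |Y|^2, and |U U^T| is at least
    |U|^2 / sqrt n because the trace of U U^T is |U|^2; dividing by |U| shows
    that the gradient grows cubically ([factorization_grad_ge]).  A quadratic
    Hessian is dominated by an arbitrarily small multiple of a cubic gradient
    plus a constant ([factorization_smooth]).

    Part (ii).  For isotropic phi, the conjugate is radial,
    phi^* y = G |y| with G s the supremum of s t - h t over t >= 0, and
    G = h^* on the half-line s >= 0.  Strong convexity of phi with modulus mu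
    makes G convex and semiconcave, hence differentiable with a Lipschitz
    derivative ([scalar_conjugate_derive1], [scalar_conjugate_lipschitz]).
    Consequently the Hessian of phi^* is bounded everywhere ([radial_hess_le]),
    and at y <> 0 its entries are controlled by G'' s and G' s / s, where
    s = |y| ([radial_hess_le_derive]).

    The kernel conditions turn this into decay.  Let s be the norm of the
    rescaled gradient and rho = |U|; cubic growth gives s >= rho^3 / a for some
    constant a and rho large.  Since G' s / s is decreasing, it is at most
    a G'(rho^3 / a) / rho^3, and the third kernel condition for the polynomial
    X^3 / a bounds this by a / rho^2; the second one bounds G'' s by
    O(1 / s) = O(1 / rho^2).  So the Hessian of phi^* decays at least as fast as
    that of f grows ([isotropic_conjugate_hess_decay]), while for bounded rho
    both Hessians are bounded.  As lambda_max is controlled by the largest entry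
    of the product of the two Hessians, the claim follows
    ([factorization_anisotropic]). *)

(** * One-variable derivatives *)

Section calc.
Context {R : realType}.

Lemma derive_line {N : nat} (F : 'rV[R]_N -> R) (x v : 'rV[R]_N) :
  'D_v F x = 'D_1 (fun t : R => F (x + t *: v)) 0.
Proof.
rewrite /derive; set g1 := fun h => h^-1 *: _; set g2 := fun h => h^-1 *: _.
suff -> : g1 = g2 by [].
rewrite funeqE /g1 /g2 => h /=.
by rewrite addr0 scale0r addr0 [_%:A]mulr1 [x + _]addrC.
Qed.

(** The limit of a divergent difference quotient is the default value 0, so an
    upper bound on the absolute value of a derivative only has to be proved
    where the derivative exists. *)
Lemma derive_default (F : R -> R) x : ~ derivable F x 1 -> 'D_1 F x = 0.
Proof. exact: dvgP. Qed.

Lemma is_derive_quadratic (F : R -> R) (x p C : R) :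
  (forall h, `|F (x + h) - F x - p * h| <= C * h ^+ 2) -> is_derive x 1 F p.
Proof.
move=> H.
suff Fp : (fun h => h^-1 *: ((F \o shift x) (h *: 1) - F x)) @ 0^' --> p.
  by apply: DeriveDef; [apply/cvg_ex; exists p | apply/cvg_lim].
have C0 : 0 <= C by have := H 1; rewrite expr1n [C * 1]mulr1; exact: le_trans (normr_ge0 _).
apply/cvgrPdist_le => /= e e0; near=> h.
have hN0 : h != 0 by near: h; exact: nbhs_dnbhs_neq.
have -> : p - h^-1 *: (F (h *: 1 + x) - F x)
        = - (h^-1 * (F (x + h) - F x - p * h)).
  rewrite [h *: 1]mulr1 [h + x]addrC /GRing.scale /=.
  by field.
rewrite normrN normrM normfV.
rewrite ler_pdivrMl ?normr_gt0 //.
apply: (le_trans (H h)); rewrite -[h ^+ 2]real_normK ?num_real // expr2 mulrA mulrC.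
apply: ler_wpM2l => //.
have hd : `|h| <= e / (C + 1).
  by near: h; apply: dnbhs0_le; rewrite divr_gt0 // ltr_wpDl.
rewrite ler_pdivlMr ?ltr_wpDl // in hd.
apply: le_trans hd; rewrite mulrC; apply: ler_wpM2l => //; lra.
Unshelve. all: by end_near. Qed.

Lemma derive_le_lipschitz (F : R -> R) (x K : R) :
  (forall h, `|F (x + h) - F x| <= K * `|h|) -> `|'D_1 F x| <= K.
Proof.
move=> H.
have K0 : 0 <= K by have := H 1; rewrite normr1 mulr1; exact: le_trans (normr_ge0 _).
have [dF|/derive_default ->] := pselect (derivable F x 1); last first.
  by rewrite normr0.
rewrite /derive -(lim_norm dF).
apply: limr_le; first exact: (is_cvg_norm dF).
near=> h.
have hN0 : h != 0 by near: h; exact: nbhs_dnbhs_neq.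
rewrite /= normrZ normfV ler_pdivrMl ?normr_gt0 // mulrC.
by rewrite [h *: 1]mulr1 [h + x]addrC.
Unshelve. all: by end_near. Qed.

End calc.

(** * Norms and eigenvalues in terms of entries *)

Section norms.
Context {R : realType}.

Lemma frobenius_norm_ge0 {m n} (A : 'M[R]_(m, n)) : 0 <= frobenius_norm A.
Proof. exact: sqrtr_ge0. Qed.

Lemma frobenius_norm_sqr {m n} (A : 'M[R]_(m, n)) :
  frobenius_norm A ^+ 2 = \sum_(i < m) \sum_(j < n) A i j ^+ 2.
Proof.
by rewrite sqr_sqrtr // sumr_ge0 // => i _; rewrite sumr_ge0 // => j _; rewrite sqr_ge0.
Qed.

Lemma rV_norm_sqr {N} (x : 'rV[R]_N) :
  frobenius_norm x ^+ 2 = \sum_(i < N) x 0 i ^+ 2.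
Proof. by rewrite frobenius_norm_sqr big_ord1. Qed.

Lemma frobenius_norm_coord {m n} (A : 'M[R]_(m, n)) i j :
  `|A i j| <= frobenius_norm A.
Proof.
rewrite -(ler_pXn2r (n := 2)) ?nnegrE ?normr_ge0 ?frobenius_norm_ge0 //.
rewrite real_normK ?num_real // frobenius_norm_sqr (bigD1 i) //= (bigD1 j) //=.
rewrite -addrA lerDl addr_ge0 ?sumr_ge0 // => k _; first exact: sqr_ge0.
by rewrite sumr_ge0 // => l _; rewrite sqr_ge0.
Qed.

Lemma frobenius_norm_le_sum {m n} (A : 'M[R]_(m, n)) :
  frobenius_norm A <= \sum_i \sum_j `|A i j|.
Proof.
have S0 : 0 <= \sum_i \sum_j `|A i j| by do 2! apply: sumr_ge0 => ? _.
rewrite -(ler_pXn2r (n := 2)) ?nnegrE ?frobenius_norm_ge0 //.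
rewrite frobenius_norm_sqr expr2 mulr_suml.
apply: ler_sum => i _; rewrite mulr_suml; apply: ler_sum => j _.
rewrite -real_normK ?num_real // expr2 ler_wpM2l //.
rewrite (bigD1 i) //= (bigD1 j) //= -addrA lerDl addr_ge0 // ?sumr_ge0 // => k _.
by rewrite sumr_ge0.
Qed.

(** Expanding the sum of squares of A b_i - p a_i, where A is the sum of the
    a_i^2 and p that of the a_i b_i, gives A times the defect of the
    inequality. *)
Lemma sum_Cauchy_Schwarz (I : finType) (a b : I -> R) :
  (\sum_i a i * b i) ^+ 2 <= (\sum_i a i ^+ 2) * (\sum_i b i ^+ 2).
Proof.
set p := \sum_i a i * b i; set A := \sum_i a i ^+ 2; set B := \sum_i b i ^+ 2.
have A0 : 0 <= A by apply: sumr_ge0 => i _; exact: sqr_ge0.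
have E x y : \sum_i (x * b i - y * a i) ^+ 2
    = x ^+ 2 * B - (x * y * 2) * p + y ^+ 2 * A.
  rewrite /B /p /A !mulr_sumr -sumrB -big_split /=.
  by apply: eq_bigr => i _; ring.
have key : 0 <= A * (A * B - p ^+ 2).
  rewrite (_ : _ * _ = \sum_i (A * b i - p * a i) ^+ 2); last by rewrite E; ring.
  by apply: sumr_ge0 => i _; exact: sqr_ge0.
have [Ap|] := ltP 0 A; first by move: key; rewrite pmulr_rge0 // subr_ge0.
move=> Al; have A00 : A = 0 by apply/eqP; rewrite eq_le Al A0.
have -> : p = 0.
  rewrite /p big1 // => i _.
  move/eqP: A00; rewrite psumr_eq0 => [/allP /(_ i)|? _]; last exact: sqr_ge0.
  by rewrite mem_index_enum sqrf_eq0 => /(_ isT) /eqP ->; rewrite mul0r.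
by rewrite A00 expr0n mul0r.
Qed.

Lemma dotE {N} (x y : 'rV[R]_N) : dot x y = \sum_i x 0 i * y 0 i.
Proof. by rewrite /dot mxE; apply: eq_bigr => i _; rewrite mxE. Qed.

Lemma dot_le_norm {N} (x y : 'rV[R]_N) :
  dot x y <= frobenius_norm x * frobenius_norm y.
Proof.
apply: (le_trans (ler_norm _)).
rewrite -(ler_pXn2r (n := 2)) ?nnegrE ?mulr_ge0 ?frobenius_norm_ge0 //.
rewrite real_normK ?num_real // exprMn !rV_norm_sqr dotE.
exact: sum_Cauchy_Schwarz.
Qed.

Lemma frobenius_normZ {N} (a : R) (x : 'rV[R]_N) :
  0 <= a -> frobenius_norm (a *: x) = a * frobenius_norm x.
Proof.
move=> a0; rewrite -[a in RHS]ger0_norm // -sqrtr_sqr -sqrtrM ?sqr_ge0 //.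
congr Num.sqrt; rewrite !big_ord1 mulr_sumr.
by apply: eq_bigr => i _; rewrite mxE exprMn.
Qed.

Lemma norm_line_sqr {N} (y : 'rV[R]_N) j (t : R) :
  frobenius_norm (y + t *: delta_mx 0 j) ^+ 2
  = frobenius_norm y ^+ 2 + 2 * y 0 j * t + t ^+ 2.
Proof.
rewrite !rV_norm_sqr (bigD1 j) //= [X in _ = X + _ + _](bigD1 j) //=.
rewrite !mxE !eqxx mulr1.
rewrite (eq_bigr (fun i => y 0 i ^+ 2)); first by ring.
by move=> i /negbTE ij; rewrite !mxE eqxx ij mulr0 addr0.
Qed.

Lemma norm_line_lipschitz {N} (y : 'rV[R]_N) j (t : R) :
  `|frobenius_norm (y + t *: delta_mx 0 j) - frobenius_norm y| <= `|t|.
Proof.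
have H (z : 'rV[R]_N) (u : R) :
    frobenius_norm (z + u *: delta_mx 0 j) <= frobenius_norm z + `|u|.
  have z0 := frobenius_norm_ge0 z.
  rewrite -(ler_pXn2r (n := 2)) ?nnegrE ?addr_ge0 ?frobenius_norm_ge0 //.
  rewrite norm_line_sqr sqrrD real_normK ?num_real // lerD2r lerD2l.
  rewrite -mulrA -[leRHS]mulr_natl ler_pM2l //.
  apply: (le_trans (ler_norm _)); rewrite normrM ler_wpM2r //.
  exact: frobenius_norm_coord.
rewrite ler_norml lerBlDl H andbT lerBrDl.
have := H (y + t *: delta_mx 0 j) (- t).
by rewrite normrN scaleNr addrK; lra.
Qed.

Lemma spectral_norm_le {N} (A : 'M[R]_N) (M : R) :
  (forall i j, `|A i j| <= M) -> spectral_norm A <= N%:R ^+ 2 * M.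
Proof.
move=> AM; apply: ge_sup => [|_ [x /= x1 <-]].
  exists (frobenius_norm (A *m (0 : 'cV[R]_N))), 0 => //=.
  by rewrite /frobenius_norm big1 ?sqrtr0 // => i _; rewrite big1 // => j _; rewrite mxE expr0n.
apply: (le_trans (frobenius_norm_le_sum _)).
have -> : N%:R ^+ 2 * M = \sum_(i < N) \sum_(j < N) M.
  by rewrite !sumr_const card_ord -mulrnA -[RHS]mulr_natl natrM expr2.
apply: ler_sum => i _; rewrite big_ord1 mxE.
apply: (le_trans (ler_norm_sum _ _ _)); apply: ler_sum => j _.
rewrite normrM -[leRHS]mulr1; apply: ler_pM => //.
exact: le_trans (frobenius_norm_coord x j 0) x1.
Qed.

(** A left eigenvector for the eigenvalue a satisfies |a| |v|_1 <= N M |v|_1.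
    The bound M >= 0 is needed for an empty spectrum, whose supremum is 0. *)
Lemma lambda_max_le {N} (A : 'M[R]_N) (M : R) : 0 <= M ->
  (forall i j, `|A i j| <= M) -> lambda_max A <= N%:R * M.
Proof.
move=> M0 AM; have NM0 : 0 <= N%:R * M by rewrite mulr_ge0.
rewrite /lambda_max.
have [->|/set0P E] := eqVneq [set a : R | eigenvalue A a] set0; first by rewrite sup0.
apply: ge_sup => // a /= /eigenvalueP [v vA v0].
set S := \sum_j `|v 0 j|.
have S0 : 0 < S.
  rewrite lt_def sumr_ge0 // andbT; apply: contra v0; rewrite psumr_eq0 // => /allP H.
  apply/eqP/rowP => j; rewrite mxE; apply/eqP.
  by have := H j; rewrite mem_index_enum normr_eq0; apply.
apply: (le_trans (ler_norm a)); rewrite -(ler_pM2r S0).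
have -> : `|a| * S = \sum_j `|(v *m A) 0 j|.
  by rewrite vA mulr_sumr; apply: eq_bigr => j _; rewrite mxE normrM.
have -> : N%:R * M * S = \sum_(j < N) \sum_i `|v 0 i| * M.
  by rewrite sumr_const card_ord -mulr_suml -[RHS]mulr_natl -/S -mulrA [M * S]mulrC.
apply: ler_sum => j _; rewrite mxE.
apply: (le_trans (ler_norm_sum _ _ _)); apply: ler_sum => i _.
by rewrite normrM ler_wpM2l.
Qed.

Lemma mulmx_coord_le {N} (A B : 'M[R]_N) (a b : R) :
  (forall i j, `|A i j| <= a) -> (forall i j, `|B i j| <= b) ->
  forall i j, `|(A *m B) i j| <= N%:R * (a * b).
Proof.
move=> Aa Bb i j; rewrite mxE; apply: (le_trans (ler_norm_sum _ _ _)).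
have -> : N%:R * (a * b) = \sum_(k < N) (a * b).
  by rewrite sumr_const card_ord -[RHS]mulr_natl.
by apply: ler_sum => k _; rewrite normrM; apply: ler_pM.
Qed.

End norms.

(** * Polynomial functions *)

Section polynomial_functions.
Context {R : realType} {N : nat}.
Implicit Types g h : 'rV[R]_N -> R.

(** The index is an upper bound on the degree. *)
Inductive polyfun : nat -> ('rV[R]_N -> R) -> Prop :=
| polyfun_cst d c : polyfun d (fun=> c)
| polyfun_coord i : polyfun 1 (fun x => x 0 i)
| polyfunD d g h : polyfun d g -> polyfun d h -> polyfun d (fun x => g x + h x)
| polyfunM d e g h :
    polyfun d g -> polyfun e h -> polyfun (d + e) (fun x => g x * h x).

(** Degree at most d - 1, where degree at most -1 means zero.  With truncated
    subtraction instead, the product rule would lose the drop in degree for the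
    term g * h' with h of degree 0. *)
Definition polyfun_pred d g : Prop :=
  if d is d'.+1 then polyfun d' g else g = (fun=> 0).

Lemma polyfun_predD d g h : polyfun_pred d g -> polyfun_pred d h ->
  polyfun_pred d (fun x => g x + h x).
Proof.
by case: d => [-> ->|d]; [rewrite /= addr0 | exact: polyfunD].
Qed.

Lemma polyfun_predM d e g h : polyfun d g -> polyfun_pred e h ->
  polyfun_pred (d + e) (fun x => g x * h x).
Proof.
move=> pg; case: e => [->|e ph]; last by rewrite addnS; exact: polyfunM.
rewrite (_ : (fun x => _) = fun=> 0); last by apply/funext => x; rewrite mulr0.
by case: (d + 0)%N => // d'; exact: polyfun_cst.
Qed.

Lemma polyfun_differentiable d g : polyfun d g -> forall x, differentiable g x.
Proof.
elim=> {d g} [d c|i|d g h _ dg _ dh|d e g h _ dg _ dh] x.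
- exact: differentiable_cst.
- exact: differentiable_coord.
- exact: differentiableD.
- exact: differentiableM.
Qed.

Lemma polyfun_derivable d g x v : polyfun d g -> derivable g x v.
Proof. by move=> pg; apply/diff_derivable/polyfun_differentiable/pg. Qed.

Lemma polyfun_derive d g i : polyfun d g ->
  polyfun_pred d (fun x => 'D_(delta_mx 0 i) g x).
Proof.
elim=> {d g} [d c|j|d g h pg dg ph dh|d e g h pg dg ph dh].
- rewrite (_ : (fun x => 'D__ _ x) = fun=> 0); last first.
    by apply/funext => x; exact: (derive_cst c).
  by case: d => // d; exact: polyfun_cst.
- rewrite (_ : (fun x => _) = fun=> (delta_mx 0 i : 'rV[R]_N) 0 j).
    exact: polyfun_cst.
  apply/funext => x.
  have dc := @derivable_id _ _ x (delta_mx 0 i).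
  have := derive_mx dc; rewrite derive_id => /matrixP /(_ 0 j) ->.
  by rewrite !mxE.
- rewrite (_ : (fun x => 'D__ _ x) =
     fun x => 'D_(delta_mx 0 i) g x + 'D_(delta_mx 0 i) h x).
    exact: polyfun_predD.
  by apply/funext => x; apply: deriveD; apply: polyfun_derivable; eassumption.
- rewrite (_ : (fun x => 'D__ _ x) =
     fun x => g x * 'D_(delta_mx 0 i) h x + h x * 'D_(delta_mx 0 i) g x).
    apply: polyfun_predD; first exact: polyfun_predM.
    by rewrite addnC; exact: polyfun_predM.
  by apply/funext => x; apply: deriveM; apply: polyfun_derivable; eassumption.
Qed.

Lemma polyfun_growth d g : polyfun d g ->
  exists2 C, 0 <= C & forall x, `|g x| <= C * (1 + frobenius_norm x) ^+ d.
Proof.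
have ge1 (x : 'rV[R]_N) : 1 <= 1 + frobenius_norm x.
  by rewrite lerDl frobenius_norm_ge0.
elim=> {d g} [d c|i|d g h _ [C C0 gC] _ [D D0 hD]|d e g h _ [C C0 gC] _ [D D0 hD]].
- exists `|c| => // x; rewrite ler_peMr //; exact: exprn_ege1.
- exists 1 => // x; rewrite mul1r expr1.
  by apply: (le_trans (frobenius_norm_coord x 0 i)); rewrite lerDr.
- exists (C + D) => [|x]; first exact: addr_ge0.
  by rewrite mulrDl; apply: (le_trans (ler_normD _ _)); apply: lerD.
- exists (C * D) => [|x]; first exact: mulr_ge0.
  by rewrite normrM exprD mulrACA; apply: ler_pM.
Qed.

Lemma polyfun_sum d (I : finType) (F : I -> 'rV[R]_N -> R) :
  (forall i, polyfun d (F i)) -> polyfun d (fun x => \sum_i F i x).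
Proof.
move=> pF; elim: (index_enum I) => [|i s IH].
  rewrite (_ : (fun x => _) = fun=> 0); first exact: polyfun_cst.
  by apply/funext => x; rewrite big_nil.
rewrite (_ : (fun x => _) = fun x => F i x + \sum_(j <- s) F j x).
  exact: polyfunD.
by apply/funext => x; rewrite big_cons.
Qed.

(** The norm of a matrix is the largest absolute value of its entries, of which there
    are finitely many, so entrywise convergence is uniform. *)
Lemma continuous_mx {T : topologicalType} {m n} (M : T -> 'M[R]_(m, n)) x :
  (forall i j, {for x, continuous (fun y => M y i j)}) -> {for x, continuous M}.
Proof.
move=> cM; apply/cvgrPdist_le => /= e e0; near=> y.
rewrite /Num.Def.normr/= mx_normrE (bigmax_le _ (ltW e0))//= => i _.
rewrite !mxE/=; move: i; near: y; apply: filter_forall => /= i.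
by have /cvgrPdist_le := cM i.1 i.2; apply.
Unshelve. all: by end_near. Qed.

Lemma differentiable_row {m} (F : 'rV[R]_N -> 'rV[R]_m) x :
  (forall i, differentiable (fun y => F y 0 i) x) -> differentiable F x.
Proof.
move=> dF.
have -> : F = \sum_(i < m) (fun y => F y 0 i *: (delta_mx 0 i : 'rV[R]_m)).
  apply/funext => y; rewrite [LHS]row_sum_delta fct_sumE.
  by apply: eq_bigr.
apply: differentiable_sum => i; exact: differentiableZl.
Qed.

Lemma polyfun_C2 d g : polyfun d g -> C2_on setT g.
Proof.
move=> pg x _; have dP e h i : polyfun e h ->
    polyfun e.-1 (fun x => 'D_(delta_mx 0 i) h x).
  move=> /(polyfun_derive i); case: e => //= ->; exact: polyfun_cst.
split; first exact: polyfun_differentiable pg x.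
- apply: differentiable_row => i.
  rewrite (_ : (fun y => _) = fun y => 'D_(delta_mx 0 i) g y).
    exact: polyfun_differentiable (dP _ _ _ pg) x.
  by apply/funext => y; rewrite mxE.
- apply: continuous_mx => i j.
  rewrite (_ : (fun y => _) =
    fun y => 'D_(delta_mx 0 j) (fun z => 'D_(delta_mx 0 i) g z) y).
    by apply/differentiable_continuous/(polyfun_differentiable (dP _ _ _ (dP _ _ _ pg))).
  by apply/funext => y; rewrite mxE.
Qed.

Lemma polyfun_hess_growth d g : polyfun d.+2 g ->
  exists2 C, 0 <= C &
    forall x i j, `|hess g x i j| <= C * (1 + frobenius_norm x) ^+ d.
Proof.
move=> pg.
have H i j : exists2 C, 0 <= C &
    forall x, `|hess g x i j| <= C * (1 + frobenius_norm x) ^+ d.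
  have [C C0 HC] := polyfun_growth
    (polyfun_derive j (polyfun_derive i pg : polyfun d.+1 _) : polyfun d _).
  by exists C => // x; rewrite mxE.
pose C i j := s2val (cid2 (H i j)).
have C0 i j : 0 <= C i j by rewrite /C; case: cid2.
exists (\sum_i \sum_j C i j); first by do 2! apply: sumr_ge0 => ? _.
move=> x i j; have : `|hess g x i j| <= C i j * (1 + frobenius_norm x) ^+ d.
  by rewrite /C; case: cid2.
move/le_trans; apply; rewrite ler_wpM2r //.
  by rewrite exprn_ge0 // addr_ge0 // frobenius_norm_ge0.
rewrite (bigD1 i) //= (bigD1 j) //= -addrA lerDl addr_ge0 ?sumr_ge0 // => k _.
by rewrite sumr_ge0.
Qed.

Lemma derive_grad g x v : differentiable g x -> 'D_v g x = dot (grad g x) v.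
Proof.
move=> dg; rewrite deriveE // {1}[v]row_sum_delta linear_sum dotE.
by apply: eq_bigr => i _; rewrite linearZ /= mxE deriveE // mulrC.
Qed.

End polynomial_functions.

(** * Growth of the factorization objective *)

Section factorization.
Context {R : realType} {n r : nat} (Y : 'M[R]_n).

Let f (x : 'rV[R]_(n * r)) : R := symmetric_factorization Y (vec_mx x : 'M[R]_(n, r)).
Let A (x : 'rV[R]_(n * r)) i j : R :=
  \sum_(k < r) x 0 (mxvec_index i k) * x 0 (mxvec_index j k).

Lemma symmetric_factorizationE x :
  f x = 2^-1 * \sum_i \sum_j (A x i j - Y i j) * (A x i j - Y i j).
Proof.
rewrite /f /symmetric_factorization frobenius_norm_sqr; congr (_ * _).
apply: eq_bigr => i _; apply: eq_bigr => j _.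
rewrite -expr2 !mxE; congr ((_ - _) ^+ 2).
by apply: eq_bigr => k _; rewrite !mxE.
Qed.

Lemma symmetric_factorization_polyfun : polyfun 4 f.
Proof.
rewrite (_ : f = fun x => 2^-1 *
  \sum_i \sum_j (A x i j + - Y i j) * (A x i j + - Y i j)); last first.
  by apply/funext => x; rewrite symmetric_factorizationE.
apply: (@polyfunM _ _ 0 4 (fun=> 2^-1)); first exact: polyfun_cst.
apply: polyfun_sum => i; apply: polyfun_sum => j.
have pA : polyfun 2 (fun x => A x i j + - Y i j).
  apply: polyfunD; last exact: polyfun_cst.
  apply: polyfun_sum => k.
  by apply: (@polyfunM _ _ 1 1); exact: polyfun_coord.
exact: (@polyfunM _ _ 2 2).
Qed.

(** Along the ray t |-> (1 + t) x each entry of U U^T is scaled by (1 + t)^2, so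
    only a scalar polynomial in t has to be differentiated. *)
Lemma factorization_radial x :
  'D_x f x = \sum_i \sum_j 2 * A x i j * (A x i j - Y i j).
Proof.
pose F i j (t : R) := 2^-1 * ((1 + t) ^+ 2 * A x i j - Y i j) ^+ 2.
rewrite derive_line (_ : (fun t => _) = \sum_i \sum_j F i j); last first.
  apply/funext => t; rewrite symmetric_factorizationE fct_sumE mulr_sumr.
  apply: eq_bigr => i _; rewrite fct_sumE mulr_sumr; apply: eq_bigr => j _.
  rewrite /F -expr2; congr (_ * (_ - _) ^+ 2).
  by rewrite mulr_sumr; apply: eq_bigr => k _; rewrite !mxE; ring.
have dF i j : is_derive (0 : R) 1 (F i j) (2 * A x i j * (A x i j - Y i j)).
  pose p : {poly R} := 2^-1 *: ((1 + 'X) ^+ 2 * (A x i j)%:P - (Y i j)%:P) ^+ 2.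
  have -> : F i j = horner p by apply/funext => t; rewrite /F /p !hornerE.
  apply: is_derive_eq.
  by rewrite /p !poly.derivE !hornerE /=; field.
have dFi i : is_derive (0 : R) 1 (\sum_j F i j)
    (\sum_j 2 * A x i j * (A x i j - Y i j)) by exact: is_derive_sum.
by have [_ ->] := is_derive_sum dFi.
Qed.

(** The entrywise identity 2 a (a - b) + b^2 = a^2 + (a - b)^2 leaves the sum of
    the squared diagonal entries of U U^T, and Cauchy-Schwarz compares it with
    the square of their sum, the trace |U|^2.  The factor n + 1 instead of n
    keeps the constant positive when n = 0. *)
Lemma factorization_radial_ge x :
  frobenius_norm x ^+ 4
  <= n.+1%:R * (dot (grad f x) x + frobenius_norm Y ^+ 2).
Proof.
rewrite -derive_grad; last exact: polyfun_differentiable symmetric_factorization_polyfun _.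
rewrite factorization_radial frobenius_norm_sqr -big_split /=.
have trE : frobenius_norm x ^+ 2 = \sum_i 1 * A x i i.
  rewrite rV_norm_sqr (reindex _ (curry_mxvec_bij n r)) /=.
  under [RHS]eq_bigr do rewrite mul1r.
  by rewrite /A pair_bigA; apply: eq_bigr => -[i k] _; rewrite expr2.
rewrite (_ : 4 = 2 * 2)%N // exprM trE.
apply: le_trans (sum_Cauchy_Schwarz _ _) _.
rewrite sumr_const card_ord expr1n.
apply: ler_pM => //.
- by apply: sumr_ge0 => i _; exact: sqr_ge0.
- by rewrite ler_nat.
apply: ler_sum => i _; rewrite -big_split /= (bigD1 i) //=.
have sq a b : 2 * a * (a - b) + b ^+ 2 = a ^+ 2 + (a - b) ^+ 2 :> R by ring.
rewrite sq -addrA lerDl addr_ge0 ?sqr_ge0 // sumr_ge0 // => j _.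
by rewrite sq addr_ge0 ?sqr_ge0.
Qed.

Lemma factorization_grad_ge : exists2 C, 0 <= C & forall x, 
  1 <= frobenius_norm x ->
  frobenius_norm x ^+ 3 <= n.+1%:R * frobenius_norm (grad f x) + C.
Proof.
exists (n.+1%:R * frobenius_norm Y ^+ 2) => [|x x1].
  by rewrite mulr_ge0 // sqr_ge0.
have x0 : 0 < frobenius_norm x by exact: lt_le_trans x1.
rewrite -(ler_pM2r x0) -exprSr; apply: (le_trans (factorization_radial_ge x)).
rewrite mulrDl mulrDr; apply: lerD.
  by rewrite -mulrA ler_pM2l // dot_le_norm.
by rewrite ler_peMr // mulr_ge0 // sqr_ge0.
Qed.

(** The quadratic 4 M p^2 is at most L1 times the cubic p^3 / (n + 1) as soon as
    p = |U| exceeds t = 4 M (n + 1) / L1, and at most 4 M t^2 otherwise. *)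
Lemma factorization_smooth L1 : 0 < L1 ->
  exists2 L0 : R, 0 < L0 & L0L1_smooth L0 L1 f.
Proof.
move=> L10; have [C C0 HC] := factorization_grad_ge.
have [K K0 HK] := polyfun_hess_growth symmetric_factorization_polyfun.
pose M := (n * r)%:R ^+ 2 * K.
have M0 : 0 <= M by rewrite mulr_ge0 // sqr_ge0.
have N0 : 0 < n.+1%:R :> R by [].
pose t := 4 * M * n.+1%:R / L1.
have t0 : 0 <= t by rewrite /t divr_ge0 ?(ltW L10) // !mulr_ge0.
have D0 : 0 <= L1 * C / n.+1%:R by rewrite divr_ge0 // mulr_ge0 // ltW.
exists (1 + 4 * M * (1 + t ^+ 2) + L1 * C / n.+1%:R).
  by rewrite !ltr_wpDr // !mulr_ge0 // addr_ge0 // sqr_ge0.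
split; first exact: polyfun_C2 symmetric_factorization_polyfun.
move=> x; set g := frobenius_norm (grad f x); set p := frobenius_norm x.
have g0 : 0 <= g by exact: frobenius_norm_ge0.
have p0 : 0 <= p by exact: frobenius_norm_ge0.
have Lg : 0 <= L1 * g by rewrite mulr_ge0 // ltW.
have st : 0 <= t ^+ 2 by exact: sqr_ge0.
apply: le_trans (spectral_norm_le (HK x)) _; rewrite mulrA -/M -/p.
have tE : 4 * M = L1 * t * n.+1%:R^-1.
  by rewrite /t; field; rewrite -natr1 addrC in N0; rewrite !gt_eqF.
have {}HC : 1 <= p -> p ^+ 3 * n.+1%:R^-1 <= g + C * n.+1%:R^-1.
  by move=> /HC; rewrite -/g ler_pdivrMr // mulrDl divfK ?gt_eqF // mulrC.
have n0 : 0 < n.+1%:R^-1 :> R by rewrite invr_gt0.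
move: (n.+1%:R^-1 : R) n0 D0 HC tE => q n0 D0 HC tE; clear HK.
clearbody t M p g; clear f A x Y N0 K K0.
have {}Lg : 0 <= L1 * g by rewrite mulr_ge0 // ltW.
have [p1|p1] := leP p 1.
  have : M * (1 + p) ^+ 2 <= M * 4 by rewrite ler_wpM2l //; nra.
  have : 0 <= 4 * M * t ^+ 2 by rewrite mulr_ge0 // mulr_ge0.
  lra.
have : M * (1 + p) ^+ 2 <= M * (4 * p ^+ 2) by rewrite ler_wpM2l //; nra.
have [pt|pt] := leP p t.
  have : M * (4 * p ^+ 2) <= M * (4 * t ^+ 2).
    by rewrite ler_wpM2l // ler_pM2l // ler_pXn2r.
  lra.
have : 4 * M * p ^+ 2 <= L1 * (p ^+ 3 * q).
  rewrite tE (_ : L1 * t * q * p ^+ 2 = L1 * q * (t * p ^+ 2)); last by ring.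
  rewrite (_ : L1 * (p ^+ 3 * q) = L1 * q * (p * p ^+ 2)); last by ring.
  apply: ler_wpM2l; first by rewrite mulr_ge0 ?ltW.
  by apply: ler_wpM2r; [exact: sqr_ge0 | exact: ltW].
have : L1 * (p ^+ 3 * q) <= L1 * (g + C * q) by rewrite ler_pM2l // HC // ltW.
have : 0 <= 4 * M * (1 + t ^+ 2) by rewrite mulr_ge0 // ?mulr_ge0 // addr_ge0.
lra.
Qed.

End factorization.

(** * Conjugates of scalar kernels *)

(** In this section D is the part of the effective domain of a kernel k that
    lies on the half-line t >= 0.  The hypothesis [k_mid] is strong convexity at
    midpoints, with modulus 4 c; by duality G is semiconcave with constant
    kap = 1 / (4 c). *)
Section scalar_conjugate.
Context {R : realType} (D : set R) (k : R -> R) (c : R).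
Hypotheses (c0 : 0 < c) (D0 : D 0) (k0 : k 0 = 0).
Hypotheses (D_ge0 : forall t, D t -> 0 <= t) (k_ge0 : forall t, D t -> 0 <= k t).
Hypothesis k_mid : forall t u, D t -> D u ->
  D ((t + u) / 2) /\ 2 * k ((t + u) / 2) + c * (t - u) ^+ 2 <= k t + k u.

Definition scalar_conjugate (s : R) : R := sup [set s * t - k t | t in D].

Local Notation G := scalar_conjugate.
Let kap := (4 * c)^-1.

Let kap0 : 0 < kap. Proof. by rewrite invr_gt0 mulr_gt0. Qed.

(** This is the conjugate inequality for the quadratic c t^2. *)
Let quad (d t : R) : d * t - c * t ^+ 2 <= kap * d ^+ 2.
Proof.
rewrite -subr_ge0 (_ : _ - _ = kap * (d - 2 * c * t) ^+ 2).
  by rewrite mulr_ge0 ?sqr_ge0 // ltW.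
by rewrite /kap; field; rewrite gt_eqF.
Qed.

Let k_quad t : D t -> c * t ^+ 2 <= k t.
Proof.
move=> Dt; have [Dm] := k_mid Dt D0; have := k_ge0 Dm.
by rewrite addr0 k0 subr0; lra.
Qed.

Lemma scalar_conjugate_has_sup s : has_sup [set s * t - k t | t in D].
Proof.
split; first by exists (s * 0 - k 0), 0.
exists (kap * s ^+ 2) => _ [t Dt <-].
by apply: le_trans (quad s t); have := k_quad Dt; lra.
Qed.

Lemma scalar_conjugate_ub s t : D t -> s * t - k t <= G s.
Proof. by move=> Dt; apply: sup_upper_bound (scalar_conjugate_has_sup s) _ _; exists t. Qed.

Lemma scalar_conjugate_lub s M :
  (forall t, D t -> s * t - k t <= M) -> G s <= M.
Proof.
move=> H; apply: ge_sup; first by have [] := scalar_conjugate_has_sup s.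
by move=> _ [t Dt <-]; exact: H.
Qed.

Lemma scalar_conjugate_ge0 s : 0 <= G s.
Proof. by have := scalar_conjugate_ub s D0; rewrite mulr0 k0 subr0. Qed.

Lemma scalar_conjugate_neg s : s <= 0 -> G s = 0.
Proof.
move=> s0; apply/eqP; rewrite eq_le scalar_conjugate_ge0 andbT.
apply: scalar_conjugate_lub => t Dt.
have := mulr_le0_ge0 s0 (D_ge0 Dt); have := k_ge0 Dt; lra.
Qed.

(** Adding the terms of the two suprema at t and u and moving to the midpoint
    gains c (t - u)^2 and costs only d (t - u). *)
Lemma scalar_conjugate_mid s d : G (s + d) + G (s - d) <= 2 * G s + kap * d ^+ 2.
Proof.
rewrite -lerBrDr; apply: scalar_conjugate_lub => t Dt.
rewrite lerBrDl -lerBrDr; apply: scalar_conjugate_lub => u Du.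
have [Dm km] := k_mid Dt Du.
have := scalar_conjugate_ub s Dm; have := quad d (t - u).
lra.
Qed.

(** Convexity of a supremum of affine functions, in the form that makes the left
    slopes at s bounded by every right slope; their supremum is then a
    subgradient. *)
Lemma scalar_conjugate_slopes s d e : 0 < d -> 0 < e ->
  (G s - G (s - d)) / d <= (G (s + e) - G s) / e.
Proof.
move=> d0 e0; rewrite ler_pdivrMr // mulrAC ler_pdivlMr //.
suff : G s * (d + e) <= e * G (s - d) + d * G (s + e) by lra.
have de0 : 0 < d + e by rewrite addr_gt0.
rewrite -ler_pdivlMr //; apply: scalar_conjugate_lub => t Dt.
rewrite ler_pdivlMr //.
have := scalar_conjugate_ub (s - d) Dt; have := scalar_conjugate_ub (s + e) Dt.
rewrite -(ler_pM2l d0) => h1; rewrite -(ler_pM2l e0) => h2; lra.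
Qed.

Lemma scalar_conjugate_subgradient s : exists p, forall d, G s + p * d <= G (s + d).
Proof.
pose S := [set (G s - G (s - d)) / d | d in [set d | 0 < d]].
have ubS e : 0 < e -> ubound S ((G (s + e) - G s) / e).
  by move=> e0 _ [d /= d0 <-]; exact: scalar_conjugate_slopes.
have S0 : S !=set0 by exists ((G s - G (s - 1)) / 1), 1 => /=.
have hS : has_sup S by split=> //; exists ((G (s + 1) - G s) / 1); exact: ubS.
exists (sup S) => d; have [d0|d0|->] := ltgtP d 0; last by rewrite mulr0 !addr0.
- have : S ((G s - G (s - - d)) / - d) by exists (- d) => //=; rewrite oppr_gt0.
  move/(sup_upper_bound hS); rewrite opprK ler_pdivrMr ?oppr_gt0 //; lra.
- have : sup S <= (G (s + d) - G s) / d by apply: ge_sup S0 (ubS _ d0).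
  by rewrite ler_pdivlMr //; lra.
Qed.

(** The subgradient at s gives the lower bound.  Using it at s - d inside the
    semiconcavity inequality gives the upper bound, so that the subgradient is
    the derivative. *)
Lemma scalar_conjugate_derive1 s d :
  0 <= G (s + d) - G s - derive1 G s * d <= kap * d ^+ 2.
Proof.
have [p pP] := scalar_conjugate_subgradient s.
have pQ e : 0 <= G (s + e) - G s - p * e <= kap * e ^+ 2.
  have := pP e; have := pP (- e); have := scalar_conjugate_mid s e.
  move=> h1 h2 h3; apply/andP; split; lra.
suff -> : derive1 G s = p by exact: pQ.
have : is_derive s 1 G p.
  apply: (@is_derive_quadratic _ _ _ _ kap) => e.
  by have /andP[h1 h2] := pQ e; rewrite ger0_norm.
by rewrite derive1E; case.
Qed.

(** Expand G at s + 2 d directly from s and in two steps through s + d: the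
    comparison costs kap (2 d)^2.  The lower bound is the monotonicity of the
    derivative of a convex function. *)
Lemma scalar_conjugate_mono_lip s d :
  0 <= (derive1 G (s + d) - derive1 G s) * d <= 4 * kap * d ^+ 2.
Proof.
have /andP[] := scalar_conjugate_derive1 s d.
have /andP[] := scalar_conjugate_derive1 (s + d) (- d).
have /andP[] := scalar_conjugate_derive1 (s + d) d.
have /andP[] := scalar_conjugate_derive1 s (d + d).
rewrite addrK [s + (d + d)]addrA => h1 h2 h3 h4 h5 h6 h7 h8; apply/andP; split; lra.
Qed.

Lemma scalar_conjugate_lipschitz s d :
  `|derive1 G (s + d) - derive1 G s| <= 4 * kap * `|d|.
Proof.
have [->|dN0] := eqVneq d 0; first by rewrite addr0 subrr !normr0 mulr0.
rewrite -(ler_pM2r (x := `|d|)) ?normr_gt0 // -normrM -[leRHS]mulrA -normrM -expr2.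
have /andP[h1 h2] := scalar_conjugate_mono_lip s d.
by rewrite ger0_norm // ger0_norm // sqr_ge0.
Qed.

(** G vanishes on the negative half-line because k >= 0 and k 0 = 0. *)
Lemma scalar_conjugate_derive1_0 : derive1 G 0 = 0.
Proof.
set p := derive1 G 0.
have H x : 0 <= x -> 0 <= p * x <= kap * x ^+ 2.
  move=> x0; have := scalar_conjugate_derive1 0 (- x).
  by rewrite add0r !scalar_conjugate_neg ?oppr_le0 // subr0 sub0r mulrN opprK sqrrN.
apply/eqP; rewrite eq_le; apply/andP; split; last first.
  by have := H 1 ler01; rewrite mulr1 => /andP[].
rewrite leNgt; apply/negP => p0.
have x0 : 0 < p / (2 * kap) by rewrite divr_gt0 // mulr_gt0.
have /andP[_] := H _ (ltW x0); rewrite [leRHS]mulrA ler_pM2r // mulrA.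
rewrite (_ : kap * p / (2 * kap) = p / 2); first by lra.
by field; rewrite gt_eqF.
Qed.

Lemma scalar_conjugate_derive1_ge0 s : 0 <= s -> 0 <= derive1 G s.
Proof.
rewrite le_eqVlt => /predU1P[<-|s0]; first by rewrite scalar_conjugate_derive1_0.
have /andP[+ _] := scalar_conjugate_mono_lip 0 s.
by rewrite add0r scalar_conjugate_derive1_0 subr0 pmulr_lge0.
Qed.

End scalar_conjugate.

(** * Hessians of radial functions *)

(** G stands for the profile of a radial function, and g for its derivative. *)
Section radial.
Context {R : realType} {N : nat} (G g : R -> R) (C L : R).
Hypothesis G_taylor : forall s d, `|G (s + d) - G s - g s * d| <= C * d ^+ 2.
Hypothesis g_lip : forall s d, `|g (s + d) - g s| <= L * `|d|.
Hypothesis g0 : g 0 = 0.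
Implicit Types y : 'rV[R]_N.

Local Notation line y j t := (y + t *: delta_mx 0 j).
Local Notation nrm := frobenius_norm.

Let F (y : 'rV[R]_N) : R := G (nrm y).

Let L0 : 0 <= L.
Proof. by have := g_lip 0 1; rewrite normr1 mulr1; exact: le_trans (normr_ge0 _). Qed.

Let g_le s : `|g s| <= L * `|s|.
Proof. by have := g_lip 0 s; rewrite add0r g0 subr0. Qed.

Let norm0 y : nrm y = 0 -> y = 0.
Proof.
move=> y0; apply/rowP => i; apply/eqP; rewrite mxE -normr_eq0 eq_le normr_ge0 andbT.
by rewrite -y0 frobenius_norm_coord.
Qed.

Lemma norm_line_derive y j : 0 < nrm y ->
  is_derive (0 : R) 1 (fun t => nrm (line y j t)) (y 0 j / nrm y).
Proof.
move=> y0; pose p : {poly R} := (nrm y ^+ 2)%:P + (2 * y 0 j) *: 'X + 'X^2.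
have -> : (fun t => nrm (line y j t)) = Num.sqrt \o horner p.
  apply/funext => t /=; rewrite -[LHS]ger0_norm ?frobenius_norm_ge0 // -sqrtr_sqr.
  by rewrite norm_line_sqr /p !hornerE.
have p0 : p.[0] = nrm y ^+ 2 by rewrite /p !hornerE; ring.
have dp : is_derive (0 : R) 1 (horner p) (2 * y 0 j).
  by apply: is_derive_eq; rewrite /p !poly.derivE !hornerE /=; ring.
have ds : is_derive p.[0] 1 Num.sqrt (2 * nrm y)^-1.
  rewrite -[nrm y in X in is_derive _ _ _ X]ger0_norm ?frobenius_norm_ge0 // -sqrtr_sqr -p0.
  by apply: is_derive1_sqrt; rewrite p0 exprn_gt0.
have := is_derive1_comp ds dp.
by congr (is_derive _ _ _ _); field; rewrite gt_eqF.
Qed.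

Lemma radial_derive y i : 'D_(delta_mx 0 i) F y = g (nrm y) / nrm y * y 0 i.
Proof.
rewrite derive_line /F.
have := frobenius_norm_ge0 y; rewrite le_eqVlt => /predU1P[y0|y0].
  rewrite -y0 g0 !mul0r (norm0 (esym y0)).
  suff dG : is_derive (0 : R) 1 (fun t : R => G (nrm (line (0 : 'rV[R]_N) i t))) 0.
    exact: derive_val.
  have nE t : nrm (line (0 : 'rV[R]_N) i t) = `|t|.
    rewrite -[LHS]ger0_norm ?frobenius_norm_ge0 // -!sqrtr_sqr norm_line_sqr.
    by rewrite -(norm0 (esym y0)) -y0 (norm0 (esym y0)) mxE; congr Num.sqrt; ring.
  apply: (@is_derive_quadratic _ _ _ _ C) => t; rewrite !nE add0r normr0.
  have := G_taylor 0 `|t|.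
  by rewrite add0r g0 !mul0r real_normK ?num_real.
have dG : is_derive (nrm (line y i 0)) 1 G (g (nrm y)).
  rewrite scale0r addr0; exact: (is_derive_quadratic (G_taylor _)).
have := @is_derive1_comp _ G (fun t => nrm (line y i t)) _ _ _ dG
  (norm_line_derive i y0).
by move=> H; rewrite (@derive_val _ _ _ _ _ _ _ H) mulrA mulrAC.
Qed.

Let E y i := g (nrm y) / nrm y * y 0 i.

Let hessE y i j : hess F y i j = 'D_1 (fun t : R => E (line y j t) i) 0.
Proof.
rewrite mxE -(derive_line (E^~ i)); congr (derive _ _ _).
by apply/funext => z; exact: radial_derive.
Qed.

Let line_coord y i j t : line y j t 0 i = y 0 i + t * (i == j)%:R.
Proof. by rewrite !mxE eqxx. Qed.

(** The gradient g |y| y / |y| is Lipschitz: the unit vector y / |y| varies by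
    O(|t| / |y|), and is multiplied by g |y| <= L |y|. *)
Lemma radial_hess_le y i j : `|hess F y i j| <= 3 * L.
Proof.
rewrite hessE; apply: derive_le_lipschitz => t; rewrite add0r scale0r addr0.
have := norm_line_lipschitz y j t; have := frobenius_norm_coord y 0 i.
have := frobenius_norm_coord (line y j t) 0 i.
have := frobenius_norm_ge0 (line y j t); have := frobenius_norm_ge0 y.
have : `|line y j t 0 i - y 0 i| <= `|t|.
  rewrite line_coord addrC addKr normrM; case: (i == j); last by rewrite normr0 mulr0.
  by rewrite normr1 mulr1.
rewrite /E; move: (line y j t 0 i) (y 0 i) (nrm (line y j t)) (nrm y) => b a s' s.
move=> ab s0 s'0 bs as_ ss.
have t0 := normr_ge0 t.
have Lt0 : 0 <= L * `|t| by rewrite mulr_ge0.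
have bound u v : `|v| <= u -> `|g u / u * v| <= L * u.
  move=> vu; have u0 : 0 <= u by exact: le_trans vu.
  move: u0; rewrite le_eqVlt => /predU1P[<-|u0]; first by rewrite g0 !mul0r normr0 mulr0.
  rewrite -mulrA normrM -[leRHS]mulr1; apply: ler_pM => //.
    by have := g_le u; rewrite (gtr0_norm u0).
  by rewrite mulrC normrM normfV (gtr0_norm u0) ler_pdivrMr // mul1r.
have [s_0|sN0] := eqVneq s 0.
  have -> : g s / s = 0 by rewrite s_0 g0 mul0r.
  rewrite mul0r subr0; apply: (le_trans (bound _ _ bs)).
  move: ss; rewrite s_0 subr0 (ger0_norm s'0) => ss.
  have : L * s' <= L * `|t| by rewrite ler_wpM2l.
  lra.
have [s'_0|s'N0] := eqVneq s' 0.
  have -> : g s' / s' = 0 by rewrite s'_0 g0 mul0r.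
  rewrite mul0r sub0r normrN; apply: (le_trans (bound _ _ as_)).
  move: ss; rewrite s'_0 sub0r normrN (ger0_norm s0) => ss.
  have : L * s <= L * `|t| by rewrite ler_wpM2l.
  lra.
have sp : 0 < s by rewrite lt_def sN0.
have s'p : 0 < s' by rewrite lt_def s'N0.
have -> : g s' / s' * b - g s / s * a =
  (g s' - g s) * (b / s') + (g s / s) * (b - a) + (g s / s) * ((s - s') * (b / s')).
  by field; rewrite sN0 s'N0.
have bs1 : `|b / s'| <= 1 by rewrite normrM normfV (gtr0_norm s'p) ler_pdivrMr // mul1r.
have gs1 : `|g s / s| <= L.
  by rewrite normrM normfV (gtr0_norm sp) ler_pdivrMr // -[in leRHS](gtr0_norm sp).
have gg : `|g s' - g s| <= L * `|t|.
  have := g_lip s (s' - s); rewrite [s + _]addrC subrK => /le_trans; apply.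
  by rewrite ler_wpM2l.
rewrite (_ : 3 * L * `|t| = L * `|t| * 1 + L * `|t| + L * (`|t| * 1)); last by ring.
apply: (le_trans (ler_normD _ _)); apply: lerD.
  apply: (le_trans (ler_normD _ _)); apply: lerD; rewrite normrM; exact: ler_pM.
rewrite normrM; apply: ler_pM => //; rewrite normrM; apply: ler_pM => //.
by rewrite distrC.
Qed.

(** Completing the square, |y + t e_j|^2 = |y|^2 - y_j^2 + (y_j + t)^2; solving
    for t on the branch through t = 0 inverts the norm along the line when
    y_j <> 0. *)
Lemma norm_line_inverse y j : 0 < nrm y -> y 0 j != 0 ->
  exists2 tau : R -> R, derivable tau (nrm y) 1 /\ tau (nrm y) = 0 &
    \forall s \near nrm y, nrm (line y j (tau s)) = s.
Proof.
move=> y0 yj; set s0 := nrm y in y0 *; set a := y 0 j.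
pose p : {poly R} := a ^- 2 *: ('X^2 - (s0 ^+ 2)%:P) + 1%:P.
have pE s : p.[s] = a ^- 2 * (s ^+ 2 - s0 ^+ 2) + 1 by rewrite /p !hornerE.
have p0 : p.[s0] = 1 by rewrite pE subrr mulr0 add0r.
pose tau s := a * (Num.sqrt p.[s] - 1).
exists tau.
  split; last by rewrite /tau p0 sqrtr1 subrr mulr0.
  have ds : is_derive p.[s0] 1 Num.sqrt (2 * Num.sqrt p.[s0])^-1.
    by apply: is_derive1_sqrt; rewrite p0.
  have [dsp _] := is_derive1_comp ds (is_derive_poly p s0).
  have -> : tau = a *: ((Num.sqrt \o horner p) - cst 1) by apply/funext.
  by apply: derivableZ; apply: derivableB.
near=> s; have s_gt0 : 0 < s by near: s; exact: lt_nbhsr.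
have ps_gt0 : 0 < p.[s].
  by near: s; apply: (cvgr_gt p.[s0]); [exact: continuous_horner | rewrite p0].
rewrite -[LHS]ger0_norm ?frobenius_norm_ge0 // -sqrtr_sqr norm_line_sqr.
rewrite -[RHS]ger0_norm ?(ltW s_gt0) // -sqrtr_sqr -/s0 -/a; congr Num.sqrt.
have sq : Num.sqrt p.[s] ^+ 2 = a ^- 2 * (s ^+ 2 - s0 ^+ 2) + 1.
  by rewrite sqr_sqrtr ?(ltW ps_gt0) // pE.
transitivity (s0 ^+ 2 - a ^+ 2 + a ^+ 2 * Num.sqrt p.[s] ^+ 2).
  by rewrite /tau; ring.
by rewrite sq; field.
Unshelve. all: by end_near. Qed.

Let E_derive y i j : 0 < nrm y -> derivable g (nrm y) 1 ->
  is_derive (0 : R) 1 (fun t => E (line y j t) i)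
    ('D_1 g (nrm y) * (y 0 j / nrm y) * (y 0 i / nrm y)
     + g (nrm y) / nrm y * ((i == j)%:R - (y 0 j / nrm y) * (y 0 i / nrm y))).
Proof.
move=> y0 /derivableP dg; set s := nrm y in y0 dg *.
have dn := norm_line_derive j y0.
have nl0 : nrm (line y j 0) = s by rewrite scale0r addr0.
rewrite -nl0 in dg.
have dgn := @is_derive1_comp _ g (fun t => nrm (line y j t)) _ _ _ dg dn.
pose q : {poly R} := (y 0 i)%:P + (i == j)%:R *: 'X.
have dq : is_derive (0 : R) 1 (horner q) (i == j)%:R.
  by apply: is_derive_eq; rewrite /q !poly.derivE !hornerE.
have nN0 : (fun t => nrm (line y j t)) 0 != 0 by rewrite /= nl0 gt_eqF.
have dnV := @is_deriveV _ (fun t => nrm (line y j t)) _ _ _ nN0 dn.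
have := is_deriveM (is_deriveM dgn dnV) dq.
have -> : (g \o (fun t => nrm (line y j t))) * (fun t => (nrm (line y j t))^-1) * horner q
  = fun t => E (line y j t) i.
  apply/funext => t; rewrite /E line_coord /q.
  have -> : forall u v w : R -> R, (u * v * w) t = u t * v t * w t by [].
  by rewrite !hornerE /= mulrC [t * _]mulrC [RHS]mulrC.
congr (is_derive _ _ _ _).
rewrite /GRing.scale /=.
have -> : forall u v : R -> R, (u * v) 0 = u 0 * v 0 by [].
rewrite /= nl0 /q !hornerE /= -/s.
by field; rewrite gt_eqF.
Qed.

(** If the entry of the Hessian exists then so does g': when y_i and y_j are
    nonzero, g is recovered from the i-th partial derivative along the line by
    composing with the inverse of the norm. *)
Let E_derivable y i j : 0 < nrm y -> y 0 j != 0 -> y 0 i != 0 ->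
  derivable (fun t : R => E (line y j t) i) 0 1 -> derivable g (nrm y) 1.
Proof.
move=> y0 yj yi dE.
have [tau [dtau tau0] tauP] := norm_line_inverse y0 yj.
pose q : {poly R} := (y 0 i)%:P + (i == j)%:R *: 'X.
have qE t : q.[t] = line y j t 0 i by rewrite line_coord /q !hornerE mulrC.
have q0 : q.[0] != 0 by rewrite qE scale0r addr0.
have [dn _] := norm_line_derive j y0.
pose H := (fun t : R => E (line y j t) i) * (fun t : R => nrm (line y j t))
  * (fun t : R => q.[t]^-1).
have dH : derivable H 0 1.
  apply: derivableM; first exact: derivableM.
  by apply: derivableV => //; exact: derivable_horner.
have dHt : derivable (H \o tau) (nrm y) 1.
  by apply/derivable1_diffP/differentiable_comp; apply/derivable1_diffP; rewrite ?tau0.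
apply: near_eq_derivable dHt.
have ctau : {for nrm y, continuous tau}.
  by apply/differentiable_continuous/derivable1_diffP.
have cq : q.[tau s] @[s --> nrm y] --> q.[0].
  by rewrite -tau0; apply: (@continuous_comp _ _ _ tau (horner q)); last exact: continuous_horner.
near=> s.
have nz : q.[tau s] != 0 by near: s; exact: cvgr_neq0 cq _.
have s_gt0 : 0 < s by near: s; exact: lt_nbhsr.
have tauE : nrm (line y j (tau s)) = s by near: s.
have HE t : H t = E (line y j t) i * nrm (line y j t) * q.[t]^-1 by [].
by rewrite /= HE /E tauE -qE [_ * s]mulrAC divfK ?gt_eqF // mulfK.
Unshelve. all: by end_near. Qed.

(** If y_j = 0 the norm is stationary along e_j, and g being Lipschitz suffices
    to differentiate.  If y_i = 0 and i <> j the partial derivative vanishes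
    along the line.  Otherwise the entry is either the default 0 or given by the
    formula for the Hessian of a radial function. *)
Lemma radial_hess_le_derive y i j : 0 < nrm y ->
  `|hess F y i j| <= `|'D_1 g (nrm y)| + 2 * (`|g (nrm y)| / nrm y).
Proof.
move=> y0; rewrite hessE; set s := nrm y in y0 *.
have B0 : 0 <= `|g s| / s by rewrite divr_ge0 // ltW.
have D0 := normr_ge0 ('D_1 g s).
have sN0 : s != 0 by rewrite gt_eqF.
have c1 l : `|y 0 l / s| <= 1.
  by rewrite normrM normfV (gtr0_norm y0) ler_pdivrMr // mul1r frobenius_norm_coord.
have Enorm : `|g s / s| = `|g s| / s by rewrite normrM normfV (gtr0_norm y0).
have d1 : `|(i == j)%:R : R| <= 1 by case: (i == j); rewrite ?normr1 ?normr0.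
have [yj|yj] := eqVneq (y 0 j) 0.
  suff dE : is_derive (0 : R) 1 (fun t => E (line y j t) i) (g s / s * (i == j)%:R).
    rewrite (@derive_val _ _ _ _ _ _ _ dE) normrM Enorm.
    have : `|g s| / s * `|(i == j)%:R : R| <= `|g s| / s * 1 by rewrite ler_wpM2l.
    lra.
  apply: (@is_derive_quadratic _ _ _ _ (2 * L / s)) => t.
  rewrite add0r scale0r addr0 /E line_coord -/s.
  set s' := nrm (line y j t).
  have s'0 : 0 <= s' by exact: frobenius_norm_ge0.
  have s'E : s' ^+ 2 = s ^+ 2 + t ^+ 2 by rewrite norm_line_sqr yj mulr0 mul0r addr0.
  have ss' : s <= s' by rewrite -(ler_pXn2r (n := 2)) ?nnegrE ?(ltW y0) // s'E lerDl sqr_ge0.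
  have s'p : 0 < s' by exact: lt_le_trans ss'.
  have st : s' - s <= `|t|.
    by apply: le_trans (ler_norm _) _; exact: norm_line_lipschitz.
  (* since (s' - s) (s' + s) = t ^ 2 *)
  have sst : (s' - s) * s <= t ^+ 2.
    have : 0 <= (s' - s) * s' by rewrite mulr_ge0 // subr_ge0.
    by have : t ^+ 2 = (s' - s) * s' + (s' - s) * s; [rewrite mulrBl mulrBl; lra | lra].
  have EE : `|g s' / s' - g s / s| <= 2 * L / s * (s' - s).
    rewrite (_ : _ - _ = (g s' - g s) / s' - g s / s * ((s' - s) / s')); last first.
      by field; rewrite sN0 gt_eqF.
    apply: (le_trans (ler_normB _ _)).
    rewrite (_ : 2 * L / s * (s' - s) = L * (s' - s) / s + L * ((s' - s) / s)); last by ring.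
    have h0 : 0 <= (s' - s) / s' <= (s' - s) / s.
      rewrite divr_ge0 ?subr_ge0 //=; apply: ler_wpM2l; first by rewrite subr_ge0.
      by rewrite lef_pV2.
    apply: lerD.
      rewrite normrM normfV (gtr0_norm s'p).
      have := g_lip s (s' - s); rewrite [s + _]addrC subrK (ger0_norm (x := s' - s)) ?subr_ge0 // => h.
      apply: ler_pM => //; first by rewrite invr_ge0 ltW.
      by rewrite lef_pV2.
    rewrite normrM Enorm; have /andP[h1 h2] := h0; rewrite (ger0_norm h1).
    apply: ler_pM => //; rewrite ler_pdivrMr //.
    by have := g_le s; rewrite (gtr0_norm y0).
  have yt : (s' - s) * `|y 0 i + t * (i == j)%:R| <= t ^+ 2.
    have [ij|ij] := eqVneq i j.
      rewrite ij yj add0r mulr1 -real_normK ?num_real // expr2.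
      by rewrite ler_wpM2r.
    rewrite mulr0 addr0; apply: le_trans sst; rewrite ler_wpM2l ?subr_ge0 //.
    exact: frobenius_norm_coord.
  rewrite (_ : _ - _ - _ = (g s' / s' - g s / s) * (y 0 i + t * (i == j)%:R)); last first.
    by ring.
  rewrite normrM; apply: (@le_trans _ _ (2 * L / s * (s' - s) * `|y 0 i + t * (i == j)%:R|)).
    by rewrite ler_wpM2r.
  by rewrite -mulrA ler_wpM2l // divr_ge0 ?mulr_ge0 // ltW.
have [->|dEP] := pselect ((fun t : R => E (line y j t) i) = cst 0).
  by rewrite derive_cst normr0; lra.
have yi : y 0 i != 0.
  apply/eqP => yi; apply: dEP; apply/funext => t; rewrite /E line_coord yi.
  case: eqVneq => [ij|_]; last by rewrite mulr0 addr0 mulr0.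
  by rewrite -ij yi eqxx in yj.
have [dE|/derive_default ->] := pselect (derivable (fun t : R => E (line y j t) i) 0 1); last first.
  by rewrite normr0; lra.
have dg := E_derivable y0 yj yi dE.
rewrite (@derive_val _ _ _ _ _ _ _ (E_derive i j y0 dg)) -/s.
have h1 : `|'D_1 g s * (y 0 j / s) * (y 0 i / s)| <= `|'D_1 g s|.
  rewrite -mulrA normrM ler_piMr // normrM -[leRHS]mulr1; exact: ler_pM.
have h2 : `|(i == j)%:R - y 0 j / s * (y 0 i / s)| <= 2.
  apply: (le_trans (ler_normB _ _)); rewrite (_ : 2 = 1 + 1) //; apply: lerD => //.
  by rewrite normrM -[leRHS]mulr1; exact: ler_pM.
apply: (le_trans (ler_normD _ _)); apply: lerD => //.
by rewrite normrM Enorm [leRHS]mulrC ler_wpM2l.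
Qed.

End radial.

(** * Conjugates of isotropic functions *)

(** The index i0 makes the dimension positive: the profile h is then determined
    on t >= 0 by phi on the ray through the i0-th basis vector. *)
Section isotropic_conjugate.
Context {R : realType} {N : nat} (phi : 'rV[R]_N -> \bar R) (h : R -> \bar R).
Variables (mu : R) (i0 : 'I_N).
Hypotheses (mu0 : 0 < mu) (h_ge0 : forall t, (0 <= h t)%E) (h0 : h 0 = 0%E).
Hypothesis phiE : forall x, phi x = h (frobenius_norm x).
Hypothesis phi_sc : forall (x y : 'rV[R]_N) (t : R), 0 < t < 1 ->
  (phi (t *: x + (1 - t) *: y)%R
     + (mu / 2 * t * (1 - t) * frobenius_norm (x - y) ^+ 2)%R%:E
   <= t%:E * phi x + (1 - t)%R%:E * phi y)%E.

Let D := [set t : R | 0 <= t /\ (h t < +oo)%E].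
Let k t := fine (h t).
Local Notation e := (delta_mx 0 i0 : 'rV[R]_N).

Let hE t : (h t < +oo)%E -> h t = (k t)%:E.
Proof. by move=> ht; rewrite fineK // ge0_fin_numE. Qed.

Let norm_e t : frobenius_norm (t *: e) ^+ 2 = t ^+ 2.
Proof.
rewrite rV_norm_sqr (bigD1 i0) //= !mxE !eqxx mulr1 big1 ?addr0 // => j /negbTE ji.
by rewrite !mxE eqxx ji mulr0 expr0n.
Qed.

Let norm_e_ge0 t : 0 <= t -> frobenius_norm (t *: e) = t.
Proof.
by move=> t0; apply/eqP; rewrite -(eqrXn2 (n := 2)) ?frobenius_norm_ge0 // norm_e.
Qed.

Let D0 : D 0. Proof. by split=> //; rewrite h0 ltey. Qed.

Let k0 : k 0 = 0. Proof. by rewrite /k h0. Qed.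

Let D_ge0 t : D t -> 0 <= t. Proof. by case. Qed.

Let k_ge0 t : D t -> 0 <= k t. Proof. by move=> _; exact: fine_ge0. Qed.

(** Strong convexity of phi at the midpoint of two points of the ray; the
    inequality also shows that h is finite at the midpoint. *)
Let k_mid t u : D t -> D u ->
  D ((t + u) / 2) /\ 2 * k ((t + u) / 2) + mu / 4 * (t - u) ^+ 2 <= k t + k u.
Proof.
move=> [t0 ht] [u0 hu].
have half : 0 < (2^-1 : R) < 1 by lra.
have := phi_sc (t *: e) (u *: e) half.
have -> : 1 - 2^-1 = 2^-1 :> R by lra.
rewrite !scalerA -scalerDl -scalerBl norm_e !phiE !norm_e_ge0 // ?addr_ge0 ?mulr_ge0 //.
have m0 : 0 <= (t + u) / 2 by rewrite divr_ge0 ?addr_ge0.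
have -> : 2^-1 * t + 2^-1 * u = (t + u) / 2 by lra.
rewrite (hE ht) (hE hu) -!EFinM -EFinD => H.
have hm : (h ((t + u) / 2) < +oo)%E.
  by rewrite ltNge leye_eq; apply/negP => /eqP E; move: H; rewrite E addye.
split=> //; move: H; rewrite (hE hm) -EFinD lee_fin; lra.
Qed.

Let c0 : 0 < mu / 4. Proof. by rewrite divr_gt0. Qed.
Let G := scalar_conjugate D k.

Let Gset_has_sup s := scalar_conjugate_has_sup c0 D0 k0 k_ge0 k_mid s.
Let G_ub s t : D t -> s * t - k t <= G s.
Proof. exact: scalar_conjugate_ub c0 D0 k0 k_ge0 k_mid _ _. Qed.

Let G_ge0 s : 0 <= G s.
Proof. exact: scalar_conjugate_ge0 c0 D0 k0 k_ge0 k_mid _. Qed.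

(** Both phi^* and h^* reduce to G: every term of the first supremum is bounded
    by G, and every term defining G occurs among them. *)
Let conjugateE (T : Type) (b : T -> T -> R) (p : T -> \bar R) y s :
  (forall x, ((b x y)%:E - p x <= (G s)%:E)%E) ->
  (forall t, D t -> exists x, p x = h t /\ b x y = s * t) ->
  convex_conjugate b p y = (G s)%:E.
Proof.
move=> ub att; apply/eqP; rewrite eq_le; apply/andP; split.
  by apply: ge_ereal_sup => _ [x _ <-].
have [S0 Sub] := Gset_has_sup s.
rewrite -(ereal_sup_EFin Sub S0); apply: le_ereal_sup => _ [_ [t Dt <-] <-].
by have [x [px bx]] := att t Dt; exists x => //; rewrite px bx hE ?EFinB //; case: Dt.
Qed.

(** Cauchy-Schwarz bounds the terms; equality holds at the multiples of y, or at
    any vector of the given norm if y = 0. *)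
Lemma isotropic_conjugateE y :
  convex_conjugate dot phi y = (G (frobenius_norm y))%:E.
Proof.
apply: conjugateE => [x|t [t0 ht]].
  rewrite phiE; have [hx|] := ltP (h (frobenius_norm x)) +oo%E; last first.
    by rewrite leye_eq => /eqP ->; rewrite addeNy leNye.
  rewrite (hE hx) -EFinB lee_fin.
  have := G_ub (frobenius_norm y) (conj (frobenius_norm_ge0 x) hx : D _).
  by have := dot_le_norm x y; lra.
have [y0|y0] := eqVneq (frobenius_norm y) 0.
  exists (t *: e); rewrite phiE norm_e_ge0 // y0 mul0r; split=> //.
  have yz i : y 0 i = 0.
    by apply/eqP; rewrite -normr_eq0 eq_le normr_ge0 -y0 frobenius_norm_coord.
  by rewrite dotE big1 // => i _; rewrite yz mulr0.
exists ((t / frobenius_norm y) *: y).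
have ty : 0 <= t / frobenius_norm y by rewrite divr_ge0 // frobenius_norm_ge0.
rewrite phiE frobenius_normZ // divfK //; split=> //.
rewrite /dot -scalemxAl mxE -/(dot y y).
have -> : dot y y = frobenius_norm y ^+ 2 by rewrite dotE rV_norm_sqr.
by field.
Qed.

(** The terms at negative arguments t satisfy s t - h t <= 0 <= G s. *)
Lemma scalar_kernel_conjugateE s : 0 <= s ->
  convex_conjugate *%R h s = (G s)%:E.
Proof.
move=> s0; apply: conjugateE => [t|t Dt]; last by exists t; rewrite mulrC.
have [ht|] := ltP (h t) +oo%E; last first.
  by rewrite leye_eq => /eqP ->; rewrite addeNy leNye.
rewrite (hE ht) -EFinB lee_fin.
have [t0|t0] := leP 0 t; first by have := G_ub s (conj t0 ht : D _); rewrite mulrC.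
have := G_ge0 s; have : 0 <= k t by exact: fine_ge0.
by have := mulr_le0_ge0 (ltW t0) s0; lra.
Qed.

Lemma kernel_derive1 s : 0 < s ->
  derive1 (fine \o convex_conjugate *%R h) s = derive1 G s.
Proof.
move=> s0; rewrite !derive1E; apply: near_eq_derive; near=> u.
rewrite /= scalar_kernel_conjugateE //; apply/ltW; near: u; exact: lt_nbhsr.
Unshelve. all: by end_near. Qed.

Lemma kernel_derive2 s : 0 < s ->
  derive1n 2 (fine \o convex_conjugate *%R h) s = 'D_1 (derive1 G) s.
Proof.
move=> s0; rewrite derive1nS derive1n1 derive1E; apply: near_eq_derive; near=> u.
by rewrite kernel_derive1 //; near: u; exact: lt_nbhsr.
Unshelve. all: by end_near. Qed.

Let conjE : fine \o convex_conjugate dot phi = fun y => G (frobenius_norm y).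
Proof. by apply/funext => y; rewrite /= isotropic_conjugateE. Qed.

Let G_taylor s d : `|G (s + d) - G s - derive1 G s * d| <= (4 * (mu / 4))^-1 * d ^+ 2.
Proof.
have /andP[h1 h2] := scalar_conjugate_derive1 c0 D0 k0 k_ge0 k_mid s d.
by rewrite ger0_norm.
Qed.

Let G_lip s d := scalar_conjugate_lipschitz c0 D0 k0 k_ge0 k_mid s d.
Let G'0 := scalar_conjugate_derive1_0 c0 D0 k0 D_ge0 k_ge0 k_mid.
Let G'_ge0 s := @scalar_conjugate_derive1_ge0 R D k (mu / 4) c0 D0 k0 D_ge0 k_ge0 k_mid s.

Lemma isotropic_conjugate_hess_le y i j :
  `|hess (fine \o convex_conjugate dot phi) y i j|
  <= 3 * (4 * (4 * (mu / 4))^-1).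
Proof. by rewrite conjE; exact: radial_hess_le G_taylor G_lip G'0 y i j. Qed.

(** With rho^3 / a <= |y|, monotonicity of G' s / s moves the estimate from |y|
    to rho^3 / a, where the third kernel condition applies with the polynomial
    X^3 / a in the variable rho. *)
Lemma isotropic_conjugate_hess_decay (a : R) : 0 < a ->
  kernel_conditions (fine \o convex_conjugate *%R h) ->
  exists A rho1 : R, 0 <= A /\ forall rho y i j, rho1 < rho ->
    rho ^+ 3 <= a * frobenius_norm y ->
    `|hess (fine \o convex_conjugate dot phi) y i j| <= A / rho ^+ 2.
Proof.
move=> a0 [decr [C2 C20 lim2] lim3].
have [M2 [_ HM2]] : \forall y \near +oo,
    `|y * derive1n 2 (fine \o convex_conjugate *%R h) y| <= C2 + 1.
  by apply: cvgr_norm_le lim2 _ _; rewrite ger0_norm // ltrDl.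
have [M3 [_ HM3]] : \forall y \near +oo,
    derive1 (fine \o convex_conjugate *%R h) (a^-1 *: 'X^3).[y] / y <= 1.
  exact: cvgr_le (lim3 _) _ ltr01.
have {}HM3 y : M3 < y -> 0 < y -> derive1 G (y ^+ 3 / a) <= y.
  move=> /HM3 /= + y0; rewrite hornerZ hornerXn [a^-1 * _]mulrC.
  by rewrite kernel_derive1 ?divr_gt0 ?exprn_gt0 // ler_pdivrMr // mul1r.
(* Beyond m + a m, both rho and rho ^ 3 / a exceed the thresholds M2 and M3. *)
pose m := 1 + `|M2| + `|M3|.
have m1 : 1 <= m by rewrite /m -addrA lerDl addr_ge0.
have mM2 : M2 < m by have := ler_norm M2; have := normr_ge0 M3; rewrite /m; lra.
have mM3 : M3 < m by have := ler_norm M3; have := normr_ge0 M2; rewrite /m; lra.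
exists ((C2 + 3) * a), (m + a * m); split; first by rewrite mulr_ge0 ?addr_ge0 // ltW.
move=> rho y i j rhom rho3; set s := frobenius_norm y.
have am : 0 < a * m by rewrite mulr_gt0 //; lra.
have rho1 : 1 < rho by lra.
have rho0 : 0 < rho by lra.
have rho3_gt0 : 0 < rho ^+ 3 / a by rewrite divr_gt0 // exprn_gt0.
have rhos : rho ^+ 3 / a <= s by rewrite ler_pdivrMr // mulrC.
have ms : m < s.
  apply: lt_le_trans rhos; rewrite ltr_pdivlMr // mulrC.
  apply: (@lt_le_trans _ _ rho); first by lra.
  by rewrite -[leLHS]expr1; apply: ler_weXn2l => //; exact: ltW.
have s0 : 0 < s by exact: lt_le_trans rhos.
have sN0 : s != 0 by rewrite gt_eqF.
rewrite conjE; apply: le_trans (radial_hess_le_derive G_taylor G_lip G'0 i j s0) _.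
rewrite -/s (ger0_norm (G'_ge0 (ltW s0))).
have b2 : `|'D_1 (derive1 G) s| <= (C2 + 1) * (a / rho ^+ 2).
  have := HM2 _ (lt_trans mM2 ms); rewrite kernel_derive2 // normrM (gtr0_norm s0).
  rewrite mulrC -ler_pdivlMr // => /le_trans; apply.
  rewrite ler_wpM2l ?addr_ge0 //.
  rewrite -[a / _]invf_div lef_pV2 ?posrE ?divr_gt0 ?exprn_gt0 //.
  apply: le_trans rhos; rewrite ler_pM2r ?invr_gt0 //.
  by apply: ler_weXn2l => //; exact: ltW.
have b1 : derive1 G s / s <= a / rho ^+ 2.
  have := decr _ _ rho3_gt0 rhos; rewrite !kernel_derive1 // => /le_trans; apply.
  rewrite ler_pdivrMr //.
  apply: le_trans (HM3 rho _ rho0) _; first by lra.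
  rewrite (_ : a / _ * _ = rho) //; field.
  by rewrite !gt_eqF.
rewrite (_ : (C2 + 3) * a / rho ^+ 2 = (C2 + 1) * (a / rho ^+ 2) + 2 * (a / rho ^+ 2)).
  by rewrite lerD // ler_pM2l.
by ring.
Qed.

End isotropic_conjugate.

(** * Anisotropic smoothness of the factorization objective *)

Lemma reference_conjugate_hess {R : realType} {N : nat} (phi : 'rV[R]_N -> \bar R) :
  reference_function phi -> condition_I phi ->
  let H := hess (fine \o convex_conjugate dot phi) in
  (exists2 B : R, 0 <= B & forall y i j, `|H y i j| <= B) /\
  (forall a : R, 0 < a -> exists A rho1 : R, 0 <= A /\
     forall rho y i j, rho1 < rho -> rho ^+ 3 <= a * frobenius_norm y ->
       `|H y i j| <= A / rho ^+ 2).
Proof.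
(* In dimension 0 there are no entries to bound. *)
case: N phi => [|N] phi [_ _ [mu mu0 sc] _ phi0] [h [h_ge0 phiE kc]] /=.
  split; first by exists 0 => // y [].
  by move=> a a0; exists 0, 0; split=> // rho y [].
have h0 : h 0 = 0%E.
  rewrite -phi0 phiE /frobenius_norm big1 ?sqrtr0 // => i _.
  by rewrite big1 // => j _; rewrite mxE expr0n.
split=> [|a a0].
  exists (3 * (4 * (4 * (mu / 4))^-1)) => [|y i j].
    by rewrite !mulr_ge0 // invr_ge0 mulr_ge0 // divr_ge0 // ltW.
  exact: (isotropic_conjugate_hess_le ord0 mu0 h_ge0 h0 phiE sc).
exact: (isotropic_conjugate_hess_decay ord0 mu0 h_ge0 h0 phiE sc a0 kc).
Qed.

(** For rho = |U| large the gradient term forces |y| >= 1 and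
    rho^3 <= a |y|, where y is the rescaled gradient, so the entries of the two
    Hessians are O(1 / rho^2) and O(rho^2).  On a ball both are bounded. *)
Lemma factorization_anisotropic {R : realType} {n r : nat} (Y : 'M[R]_n)
    (phi : 'rV[R]_(n * r) -> \bar R) (Lbar : R) :
  reference_function phi -> condition_I phi -> 0 < Lbar ->
  exists2 L : R, 0 < L & anisotropic_smooth2 phi L Lbar
    (fun x => symmetric_factorization Y (vec_mx x : 'M[R]_(n, r))).
Proof.
move=> ref iso Lbar0; set f := (fun x => symmetric_factorization Y _).
have [C C0 HC] := @factorization_grad_ge R n r Y.
have [K K0 HK] := polyfun_hess_growth (@symmetric_factorization_polyfun R n r Y).
pose a := n.+1%:R * Lbar + C.
have a0 : 0 < a by rewrite ltr_wpDr // mulr_gt0.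
have [[B B0 HB] /(_ _ a0) [A [rho1 [A0 HA]]]] := reference_conjugate_hess ref iso.
pose m := 1 + a + `|rho1|.
have m0 : 0 <= m by rewrite /m addr_ge0 // addr_ge0 // ltW.
pose N : R := (n * r)%:R.
have N0 : 0 <= N by [].
pose T := A * (4 * K) + B * (K * (1 + m) ^+ 2).
have T1 : 0 <= A * (4 * K) by rewrite mulr_ge0 // mulr_ge0.
have T2 : 0 <= B * (K * (1 + m) ^+ 2) by rewrite mulr_ge0 // mulr_ge0 // sqr_ge0.
have T0 : 0 <= T by rewrite addr_ge0.
exists ((N * (N * T) + 1) / Lbar).
  by rewrite divr_gt0 // ltr_wpDl // !mulr_ge0.
move=> x; rewrite divfK ?gt_eqF //.
apply: (@le_trans _ _ (N * (N * T))); last by rewrite lerDl.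
apply: lambda_max_le => [|i j]; first by rewrite mulr_ge0.
set p := frobenius_norm x; set y := Lbar^-1 *: grad f x.
have p0 : 0 <= p by exact: frobenius_norm_ge0.
have [pm|pm] := leP p m.
  apply: le_trans (mulmx_coord_le (HB y) (HK x) i j) _.
  rewrite ler_wpM2l //; apply: (@le_trans _ _ (B * (K * (1 + m) ^+ 2))).
    have [m1 p1] : 0 <= 1 + m /\ 0 <= 1 + p by split; exact: addr_ge0.
    by rewrite ler_wpM2l // ler_wpM2l // ler_pXn2r // lerD2l.
  by rewrite /T lerDr.
have p1 : 1 < p by have := normr_ge0 rho1; rewrite /m in pm; lra.
have rp : rho1 < p by have := ler_norm rho1; rewrite /m in pm; lra.
have ap : a < p by have := normr_ge0 rho1; rewrite /m in pm; lra.
have pp0 : 0 < p by lra.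
have p3 : p <= p ^+ 3 by rewrite -[leLHS]expr1; apply: ler_weXn2l => //; exact: ltW.
have yE : frobenius_norm (grad f x) = Lbar * frobenius_norm y.
  by rewrite /y frobenius_normZ ?invr_ge0 ?(ltW Lbar0) // mulVKf // gt_eqF.
have p3y : p ^+ 3 <= n.+1%:R * Lbar * frobenius_norm y + C.
  by rewrite -mulrA -yE; apply: HC; exact: ltW.
have y1 : 1 <= frobenius_norm y.
  rewrite leNgt; apply/negP => y1.
  have : n.+1%:R * Lbar * frobenius_norm y <= n.+1%:R * Lbar * 1.
    by rewrite ler_wpM2l ?mulr_ge0 ?(ltW Lbar0) // ltW.
  rewrite /a in ap; lra.
have {}p3y : p ^+ 3 <= a * frobenius_norm y.
  apply: (le_trans p3y); rewrite /a mulrDl lerD2l.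
  by rewrite ler_peMr.
have HAy i' j' := HA p y i' j' rp p3y.
apply: le_trans (mulmx_coord_le HAy (HK x) i j) _.
rewrite ler_wpM2l //; apply: (@le_trans _ _ (A * (4 * K))); last by rewrite /T lerDl.
rewrite -/p -mulrA ler_wpM2l // mulrC ler_pdivrMr ?exprn_gt0 //.
rewrite [4 * K]mulrC -mulrA ler_wpM2l //; nra.
Qed.

Theorem theorem2p13 (R : realType) (n r : nat) (Y : 'M[R]_n) (symY : Y^T = Y) :
  let f : 'rV[R]_(n * r) -> R :=
    fun x => symmetric_factorization Y (vec_mx x : 'M[R]_(n, r)) in
  (forall L1 : R, 0 < L1 -> exists2 L0 : R, 0 < L0 & L0L1_smooth L0 L1 f) /\
  (forall phi : 'rV[R]_(n * r) -> \bar R,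
     reference_function phi -> condition_S phi -> condition_I phi ->
     forall Lbar : R, 0 < Lbar ->
       exists2 L : R, 0 < L & anisotropic_smooth2 phi L Lbar f).
Proof.
split=> [L1|phi ref _ iso Lbar]; first exact: factorization_smooth.
exact: factorization_anisotropic.
Qed.
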